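(* For every integer $r>1$, there is no connected graph $H$ (possibly containing parallel edges) such that $H\prec G$ for every $2r$-regular simple graph $G$.
   Context: Graphs are finite, undirected and loopless, and may contain parallel edges unless they are called simple. For a vertex $u$ of a graph $G$, $\partial_G u$ denotes the set of edges of $G$ incident to $u$. An $H$-colouring of $G$ is a map $f:E(G)\to E(H)$ that is a proper edge-colouring (adjacent edges of $G$ receive distinct edges of $H$) such that for every $u\in V(G)$ there exists $v\in V(H)$ with $f(\partial_G u)=\partial_H v$. We write $H\prec G$ ($H$ colours $G$) if $G$ admits an $H$-colouring. *)

(* Defs.v *)
From mathcomp Require Import all_boot.

Set Implicit Arguments.
Unset Strict Implicit.
Unset Printing Implicit Defensive.

(* Edges form a type of their own, so parallel edges are distinct edges with
   the same set of ends; [card_ends] rules out loops. *)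
Record mgraph := MGraph {
  vertex : finType;
  edge : finType;
  ends : edge -> {set vertex};
  card_ends : forall e : edge, #|ends e| = 2
}.

Definition incident (G : mgraph) (u : vertex G) : {set edge G} :=
  [set e | u \in ends e].

Definition adjacent (G : mgraph) : rel (vertex G) :=
  [rel u v | [exists e : edge G, ends e == [set u; v]]].

(* The graph without vertices does not count as connected. *)
Definition connected (G : mgraph) : Prop :=
  0 < #|vertex G| /\ forall u v : vertex G, connect (@adjacent G) u v.

Definition simple (G : mgraph) : Prop := injective (@ends G).

Definition regular (k : nat) (G : mgraph) : Prop :=
  forall u : vertex G, #|incident u| = k.

(* Two edges are adjacent when they are distinct and share an end; parallel
   edges are therefore adjacent. *)
Definition edge_adjacent (G : mgraph) (e e' : edge G) : Prop :=
  e != e' /\ exists u : vertex G, u \in ends e /\ u \in ends e'.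

Definition proper_edge_colouring (G : mgraph) (C : Type) (f : edge G -> C)
  : Prop :=
  forall e e' : edge G, edge_adjacent e e' -> f e <> f e'.

Definition is_colouring (H G : mgraph) (f : edge G -> edge H) : Prop :=
  proper_edge_colouring f /\
  forall u : vertex G, exists v : vertex H, f @: incident u = incident v.

Definition colours (H G : mgraph) : Prop :=
  exists f : edge G -> edge H, is_colouring f.

(* Main.v *)
Require Import Defs.
From mathcomp Require Import all_boot zify.

(** Let [f] be an [H]-colouring of [G] and let [g] send a vertex [u] of [G] to
    a vertex [v] of [H] with [f (∂u) = ∂v]. For a set [S] of vertices of [G],
    let [T] be the set of vertices of [H] having an odd number of preimages in
    [S]. Every colour class of [f] is a matching, so a colour lies in the edge
    cut of [T] iff it occurs an odd number of times in the edge cut of [S].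

    Taking [G] complete on [2r+1] vertices and [S] everything, [T] is nonempty
    with empty cut; as [H] is connected, [T] is everything, so [g] is onto.
    Taking for [G] a graph with a cut vertex joined by exactly two edges to a
    component [S] of the rest, these two edges have distinct colours, so [H]
    has a set [T] whose cut has exactly two edges. Going back to the complete
    graph, a vertex of [U = g^-1(T)] is joined to all vertices outside [U] by
    edges with distinct colours, all in the cut of [T]; so at most two vertices
    lie outside [U], and likewise inside. Hence [2r+1 <= 4]. *)

Set Implicit Arguments.
Unset Strict Implicit.
Unset Printing Implicit Defensive.

(** * Parity and edge cuts *)

Lemma odd_sum (I : finType) (P : pred I) (F : I -> nat) :
  odd (\sum_(i | P i) F i) = odd #|[set i | P i & odd (F i)]|.
Proof.
rewrite cardsE -sum1_card big_mkcondr /= !(big_morph odd oddD (erefl _)).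
by apply: eq_bigr => i _; case: (odd (F i)).
Qed.

(** As an edge has two ends, an odd intersection means exactly one end in [S]; the parity form suits
    counting modulo 2. *)
Definition cut (G : mgraph) (S : {set vertex G}) : {set edge G} :=
  [set e | odd #|ends e :&: S|].

Lemma ends_pair (G : mgraph) (e : edge G) (u v : vertex G) :
  u \in ends e -> v \in ends e -> u != v -> ends e = [set u; v].
Proof.
move=> ue ve uv; apply/esym/eqP; rewrite eqEcard card_ends cards2 uv andbT.
by apply/subsetP => w /set2P[] ->.
Qed.

Lemma cut_pair (G : mgraph) (S : {set vertex G}) (e : edge G) (u v : vertex G) :
  u \in ends e -> v \in ends e -> u \in S -> v \notin S -> e \in cut S.
Proof.
move=> ue ve uS vS; have uv : u != v by apply: contraNneq vS => <-.
rewrite inE (ends_pair ue ve uv) (_ : _ :&: S = [set u]) ?cards1 //.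
apply/setP => w; rewrite !inE; case: (eqVneq w u) => [->|_] /=; first by rewrite uS.
by case: (eqVneq w v) => [->|] //=; apply: negPf.
Qed.

Lemma cutC (G : mgraph) (S : {set vertex G}) : cut (~: S) = cut S.
Proof.
apply/setP => e; rewrite !inE; have := cardsID S (ends e).
rewrite card_ends setDE => /(congr1 odd); rewrite oddD.
by case: (odd _); case: (odd _).
Qed.

Lemma connected_cut0 (G : mgraph) (S : {set vertex G}) (u v : vertex G) :
  connected G -> cut S = set0 -> u \in S -> v \in S.
Proof.
move=> [_ conn] S0 uS.
have closedS : closed (@adjacent G) (mem S).
  have sub x y : adjacent x y -> x \in S -> y \in S.
    case/existsP => e /eqP exy xS; apply/negPn/negP => yS.
    have : e \in cut S by apply: (cut_pair _ _ xS yS); rewrite exy !inE eqxx ?orbT.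
    by rewrite S0 inE.
  move=> x y xy; apply/idP/idP; first exact: sub xy.
  by apply: sub; move: xy; rewrite /adjacent /= setUC.
by rewrite -[v \in S](closed_connect closedS (conn u v)).
Qed.

(** * Transporting vertex sets and cuts along a colouring *)

Section Colouring.

Variables (H G : mgraph) (f : edge G -> edge H) (g : vertex G -> vertex H).
Hypothesis f_proper : proper_edge_colouring f.
Hypothesis fg : forall u, f @: incident u = incident (g u).

(** The pushforward of the indicator function of [S] along [g], modulo 2. *)
Definition odd_fibres (S : {set vertex G}) : {set vertex H} :=
  [set x | odd #|[set u in S | g u == x]|].

Lemma colouring_inj (u : vertex G) : {in incident u &, injective f}.
Proof.
move=> e e'; rewrite !inE => ue ue' ff; apply/eqP/negPn/negP => ee'.
by apply: (f_proper (e := e) (e' := e')) => //; split=> //; exists u.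
Qed.

Lemma colour_ends (e : edge G) (u : vertex G) :
  u \in ends e -> g u \in ends (f e).
Proof.
move=> ue; have : f e \in incident (g u) by rewrite -fg imset_f // inE.
by rewrite inE.
Qed.

Lemma card_colour_incident (u : vertex G) (h : edge H) :
  #|[set e in incident u | f e == h]| = (g u \in ends h).
Proof.
have -> : (g u \in ends h) = (h \in f @: incident u) by rewrite fg inE.
case: imsetP => [[e eu ->] | no].
  rewrite (_ : [set _ in _ | _] = [set e]) ?cards1 //.
  apply/setP => e'; rewrite in_set in_set1.
  by apply/andP/eqP => [[e'u /eqP] | -> //]; apply: (colouring_inj e'u eu).
apply/eqP; rewrite cards_eq0; apply/eqP/setP => e; rewrite !inE.
by apply/negP => /andP[ue /eqP fe]; apply: no; exists e; rewrite ?inE.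
Qed.

(** Double counting modulo 2 of the pairs of a vertex [u] in [S] and an edge of colour [h] at [u].
    By [card_colour_incident] there is one such edge if [g u] is an end of [h], and none
    otherwise. *)
Lemma mem_cut_odd_fibres (S : {set vertex G}) (h : edge H) :
  (h \in cut (odd_fibres S)) = odd #|[set e in cut S | f e == h]|.
Proof.
have -> : [set e in cut S | f e == h] =
    [set e | f e == h & odd #|ends e :&: S|].
  by apply/setP => e; rewrite !inE andbC.
rewrite -odd_sum inE.
have -> : ends h :&: odd_fibres S =
    [set x | x \in ends h & odd #|[set u in S | g u == x]|].
  by apply/setP => x; rewrite !inE.
rewrite -odd_sum; congr odd.
transitivity (\sum_(u in S) (g u \in ends h : nat)).
  rewrite (eq_bigr (fun x => \sum_(u in S) (g u == x : nat))); last first.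
    move=> x _; rewrite -sum1_card -big_mkcondr /=.
    by apply: eq_bigl => u; rewrite inE.
  rewrite exchange_big /=; apply: eq_bigr => u _.
  rewrite -big_mkcondr /= sum1_card; case: (boolP (g u \in ends h)) => guh.
    rewrite (@eq_card1 _ (g u)) // => x; rewrite !inE unfold_in [g u == x]eq_sym.
    by case: (eqVneq x (g u)) => [->|]; rewrite ?guh ?andbF.
  rewrite eq_card0 // => x; rewrite !inE unfold_in [g u == x]eq_sym.
  by case: (eqVneq x (g u)) => [->|]; rewrite ?(negPf guh) ?andbF.
transitivity (\sum_(u in S) \sum_(e | f e == h) (u \in ends e : nat)).
  apply: eq_bigr => u _; rewrite -card_colour_incident -sum1_card -big_mkcondr.
  by apply: eq_bigl => e; rewrite !inE andbC.
rewrite exchange_big /=; apply: eq_bigr => e _.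
rewrite -sum1_card -big_mkcondr /=.
by apply: eq_bigl => u; rewrite !inE andbC.
Qed.

Lemma cut_odd_fibres_inj (S : {set vertex G}) :
  {in cut S &, injective f} -> cut (odd_fibres S) = f @: cut S.
Proof.
move=> f_inj; apply/setP => h; rewrite mem_cut_odd_fibres.
case: imsetP => [[e eS ->] | no].
  rewrite (_ : [set _ in _ | _] = [set e]) ?cards1 //.
  apply/setP => e'; rewrite in_set in_set1.
  by apply/andP/eqP => [[e'S /eqP] | -> //]; apply: f_inj.
rewrite (_ : [set _ in _ | _] = set0) ?cards0 //.
apply/setP => e; rewrite in_set in_set0; apply/negP => /andP[eS /eqP fe].
by apply: no; exists e.
Qed.

(** The set of all vertices has an empty cut, and an odd number of vertices forces some fibre to be
    odd; by connectedness every fibre is then odd, hence nonempty. *)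
Lemma colouring_onto (x : vertex H) :
  connected H -> odd #|vertex G| -> exists u, g u = x.
Proof.
move=> Hconn Godd.
have cut0 : cut (odd_fibres setT) = set0.
  apply/setP => h; rewrite mem_cut_odd_fibres inE.
  rewrite (_ : [set _ in _ | _] = set0) ?cards0 //.
  by apply/setP => e; rewrite !inE setIT card_ends.
have [y yT] : exists y, y \in odd_fibres setT.
  apply/set0Pn; apply: contraTneq Godd => T0.
  rewrite -sum1_card (partition_big g xpredT) //= odd_sum.
  rewrite (_ : [set _ | _] = odd_fibres setT); first by rewrite T0 cards0.
  apply/setP => y; rewrite !inE /= sum1_card; congr (odd _).
  by apply: eq_card => u; rewrite !inE.
have /(connected_cut0 x Hconn cut0) := yT.
rewrite inE => /odd_gt0; rewrite card_gt0 => /set0Pn[u].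
by rewrite !inE => /eqP; exists u.
Qed.

Lemma card_preimsetC_cut (T : {set vertex H}) (u : vertex G) :
  (forall w, u != w -> exists e, ends e = [set u; w]) ->
  g u \in T -> #|~: (g @^-1: T)| <= #|cut T|.
Proof.
(* [E] links the two sides: each [w] outside the preimage gives its own edge [uw] in [E], and [f] is
   injective on the edges at [u]. *)
move=> u_dom uT; pose E := [set e in incident u | f e \in cut T].
have -> : #|~: (g @^-1: T)| = #|[set [set u; w] | w in ~: (g @^-1: T)]|.
  apply/esym/card_in_imset => w w'; rewrite !inE => wT _ /setP/(_ w).
  rewrite !inE eqxx orbT => /esym/orP[/eqP wu | /eqP //].
  by rewrite wu uT in wT.
apply: (@leq_trans #|E|).
  apply: leq_trans (leq_imset_card (@ends G) (mem E)); apply: subset_leq_card.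
  apply/subsetP => _ /imsetP[w wT ->]; rewrite !inE in wT.
  have [e ew] : exists e, ends e = [set u; w].
    by apply: u_dom; apply: contraNneq wT => <-.
  rewrite -ew; apply: imset_f; have ue : u \in ends e by rewrite ew !inE eqxx.
  have we : w \in ends e by rewrite ew !inE eqxx orbT.
  rewrite in_set inE ue /=.
  exact: (cut_pair (colour_ends ue) (colour_ends we)).
rewrite -(@card_in_imset _ _ f (mem E)); last first.
  move=> e e'; rewrite !inE => /andP[eu _] /andP[e'u _].
  by apply: (@colouring_inj u); rewrite inE.
apply: subset_leq_card; apply/subsetP => _ /imsetP[e eE ->].
by move: eE; rewrite in_set => /andP[].
Qed.

End Colouring.

Lemma colouring_vertex_map (H G : mgraph) (f : edge G -> edge H) :
  is_colouring f ->
  proper_edge_colouring f /\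
  exists g : vertex G -> vertex H, forall u, f @: incident u = incident (g u).
Proof. by case=> fP /fin_all_exists. Qed.

(** * Simple graphs from symmetric relations *)

Section RelGraph.

Variables (T : finType) (e : rel T).

(* Edges are the two-element cliques of [e]; the diagonal of [e] is ignored. *)
Definition rel_edge : pred {set T} :=
  fun A => (#|A| == 2) && [forall x in A, forall y in A, (x != y) ==> e x y].

Lemma card_rel_edge (A : {A : {set T} | rel_edge A}) : #|val A| = 2.
Proof. by case: A => A /= /andP[/eqP]. Qed.

Definition rel_graph : mgraph := MGraph card_rel_edge.

Lemma rel_graph_simple : simple rel_graph.
Proof. exact: val_inj. Qed.

Lemma rel_graph_ends (a : edge rel_graph) (x y : T) :
  x \in ends a -> y \in ends a -> x != y -> e x y.
Proof.
by case: a => A /= /andP[_ /'forall_in_forall_inP H] xA yA; apply/implyP/H.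
Qed.

Hypothesis e_sym : symmetric e.

Lemma rel_graph_edge (x y : T) :
  x != y -> e x y -> exists a : edge rel_graph, ends a = [set x; y].
Proof.
move=> xy exy; have A_edge : rel_edge [set x; y].
  rewrite /rel_edge cards2 xy; apply/'forall_in_forall_inP => u.
  by move=> /set2P[] -> v /set2P[] ->; rewrite ?eqxx ?exy ?implybT // e_sym exy implybT.
by exists (exist (fun A => is_true (rel_edge A)) _ A_edge).
Qed.

(** Taking [S] to be all points but [x] gives the degree of [x]; taking one copy next to the hub
    gives the size of its cut. *)
Lemma card_incident_rel (S : {set T}) (x : T) : x \notin S ->
  #|[set a in incident (x : vertex rel_graph) | [exists y in S, y \in ends a]]|
    = #|[set y in S | e x y]|.
Proof.
move=> xS; have xNy y : y \in S -> x != y by apply: contraTneq => <-.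
rewrite -(card_imset _ rel_graph_simple).
rewrite -[RHS](@card_in_imset _ _ (fun y => [set x; y])); last first.
  move=> y y'; rewrite !inE => /andP[/xNy xy _] _ /setP/(_ y).
  by rewrite !inE eqxx orbT [y == x]eq_sym (negPf xy) /= => /esym/eqP.
congr #|pred_of_set _|; apply/setP => A.
apply/imsetP/imsetP => [[a] | [y]].
  rewrite !inE => /andP[xa /exists_inP[y yS ya]] ->.
  have xy := xNy y yS.
  exists y; last exact: (ends_pair xa ya xy).
  by rewrite inE yS (rel_graph_ends xa ya xy).
rewrite inE => /andP[yS exy] ->; have [a ea] := rel_graph_edge (xNy y yS) exy.
exists a => //; rewrite !inE ea !inE eqxx /=.
by apply/exists_inP; exists y; rewrite ?inE ?eqxx ?orbT.
Qed.

Lemma card_incident_rel_graph (x : T) :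
  #|incident (x : vertex rel_graph)| = #|[set y | (y != x) && e x y]|.
Proof.
transitivity #|[set y in [set~ x] | e x y]|; last first.
  by apply: eq_card => y; rewrite !inE.
rewrite -card_incident_rel ?inE ?eqxx //; apply: eq_card => a; rewrite !inE.
case: (boolP (x \in ends a)) => //= xa; apply/esym/exists_inP.
have /set0Pn[y] : ends a :\ x != set0.
  have := cardsD1 (x : vertex rel_graph) (ends a).
  by rewrite xa (card_ends a) add1n -card_gt0 => -[<-].
by rewrite in_setD1 => /andP[yx ya]; exists y; rewrite ?inE.
Qed.

End RelGraph.

(** * The two regular test graphs *)

Section TestGraphs.

Variable r : nat.

Definition complete : mgraph := rel_graph (fun _ _ : 'I_(2 * r).+1 => true).

Lemma complete_regular : regular (2 * r) complete.
Proof.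
move=> u; rewrite card_incident_rel_graph //.
rewrite (_ : [set _ | _] = [set~ u]); last by apply/setP => y; rewrite !inE andbT.
by rewrite cardsC1 card_ord.
Qed.

(* The hub [None] is joined to the points [0] and [1] of each of [r] complete
   graphs on [2r+1] vertices, from which the edge [01] has been removed. *)
Definition hub_rel : rel (option ('I_r * 'I_(2 * r).+1)) :=
  fun p q => match p, q with
  | None, None => false
  | None, Some (_, j) | Some (_, j), None => j < 2
  | Some (i, j), Some (i', j') => (i == i') && ((2 <= j) || (2 <= j'))
  end.

Definition hub_graph : mgraph := rel_graph hub_rel.

Lemma hub_rel_sym : symmetric hub_rel.
Proof. by move=> [[i j]|] [[i' j']|] //=; rewrite eq_sym orbC. Qed.

Hypothesis r_gt0 : 0 < r.

Lemma card_ord_lt2 : #|[set j : 'I_(2 * r).+1 | j < 2]| = 2.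
Proof.
have r1 : 1 < (2 * r).+1 by lia.
rewrite (_ : [set _ | _] = [set ord0; inord 1]).
  by rewrite cards2 -val_eqE /= inordK.
by apply/setP => j; rewrite !inE -!val_eqE /= inordK //; lia.
Qed.

Lemma hub_graph_regular : regular (2 * r) hub_graph.
Proof.
move=> u; rewrite card_incident_rel_graph; last exact: hub_rel_sym.
case: u => [[i j]|].
  (* The neighbours of [(i, j)] are the other points of its complete graph,
     except that the missing neighbour is replaced by the hub. *)
  pose nbr (k : 'I_(2 * r).+1) := if (j < 2) && (k < 2) then None else Some (i, k).
  rewrite (_ : [set _ | _] = [set nbr k | k in [set~ j]]).
    rewrite card_in_imset ?cardsC1 ?card_ord // => k k'; rewrite !inE /nbr -!val_eqE /=.
    case: ifP; case: ifP => // kP k'P kj k'j; last by case.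
    (* Both points map to the hub, so both are the unique point below 2 other than [j]. *)
    by move=> _; apply/val_inj => /=; lia.
  apply/setP => y; rewrite inE; apply/andP/imsetP.
    case: y => [[i' k]|] /=; rewrite /nbr => -[yj].
      case/andP=> /eqP ii jk; exists k; last by rewrite ii ifF //; lia.
      by rewrite !inE; apply: contraNneq yj => ->; rewrite ii.
    (* The hub is the image under [nbr] of the other point below 2. *)
    move=> j2; have [k k2 kj] : exists2 k : 'I_(2 * r).+1, k < 2 & k != j.
      have : [set k : 'I_(2 * r).+1 | k < 2] :\ j != set0.
        rewrite -card_gt0; have := cardsD1 j [set k : 'I_(2 * r).+1 | k < 2].
        by rewrite card_ord_lt2 inE j2; lia.
      by case/set0Pn => k; rewrite !inE => /andP[]; exists k.
    by exists k; rewrite ?inE ?j2 ?k2.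
  case=> k; rewrite !inE /nbr => kj ->; case: ifP => [/andP[]|] // jk.
  split; last by rewrite /= eqxx; lia.
  by apply: contraNneq kj => -[->].
rewrite (_ : [set _ | _] = some @: setX setT [set j : 'I_(2 * r).+1 | j < 2]).
  rewrite card_imset; last by move=> ? ? [].
  by rewrite cardsX cardsT card_ord card_ord_lt2 mulnC.
apply/setP => y; rewrite inE; apply/idP/imsetP => [|[[i j]]].
  by case: y => [[i j]|] //= j2; exists (i, j); rewrite ?inE.
by rewrite !inE /= => j2 ->.
Qed.

(** One copy serves as [S]: distinct copies are not joined, so only its two edges to the hub leave
    it. Their sharing the hub is what later gives them distinct colours. *)
Lemma hub_graph_cut : exists S : {set vertex hub_graph},
  cut S \subset incident (None : vertex hub_graph) /\ #|cut S| = 2.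
Proof.
pose S : {set vertex hub_graph} := [set Some (Ordinal r_gt0, j) | j in setT].
have NS : None \notin S by apply/imsetP => -[].
have sub : cut S \subset incident (None : vertex hub_graph).
  apply/subsetP => a aS; rewrite inE; apply: contraTT aS => Na.
  have [p [q [pq eq_a]]] : exists p q, p != q /\ ends a = [set p; q].
    by have /eqP/cards2P[p [q] [pq ->]] := card_ends a; exists p, q.
  have pa : p \in ends a by rewrite eq_a !inE eqxx.
  have qa : q \in ends a by rewrite eq_a !inE eqxx orbT.
  (* An edge avoiding the hub stays within one copy. *)
  have pqS : (p \in S) = (q \in S).
    have := rel_graph_ends pa qa pq.
    have mem_S i j : (Some (i, j) \in S) = (i == Ordinal r_gt0).
      by apply/imsetP/eqP => [[k _ [->]] // | ->]; exists j.
    move: pa qa; case: (p) => [[i j]|]; last by rewrite (negPf Na).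
    case: (q) => [[i' j']|]; last by rewrite (negPf Na).
    by move=> _ _ /= /andP[/eqP -> _]; rewrite !mem_S.
  rewrite inE; case: (boolP (p \in S)) => pS.
    by rewrite (setIidPl _) ?card_ends // eq_a subUset !sub1set -pqS pS.
  rewrite (_ : _ :&: _ = set0) ?cards0 //; apply/setP => x.
  rewrite eq_a !inE; case: eqVneq => [->|_] /=; first by rewrite (negPf pS).
  by case: eqVneq => [->|_] //=; rewrite -pqS (negPf pS).
exists S; split=> //.
transitivity #|[set a in incident (None : vertex hub_graph) | [exists y in S, y \in ends a]]|.
  apply: eq_card => a; rewrite in_set; apply/idP/andP => [aS | [Na /exists_inP[y yS ya]]].
    split; first exact: (subsetP sub).
    move: aS; rewrite inE => /odd_gt0; rewrite card_gt0 => /set0Pn[y] /setIP[ya yS].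
    by apply/exists_inP; exists y.
  by apply: (cut_pair ya _ yS NS); rewrite inE in Na.
rewrite card_incident_rel //; last exact: hub_rel_sym.
rewrite -[RHS]card_ord_lt2.
rewrite -[RHS](@card_imset _ _ (fun j => Some (Ordinal r_gt0, j))); last by move=> ? ? [].
apply: eq_card => y; rewrite inE; apply/andP/imsetP => [[/imsetP[j _ ->] /= j2] | [j]].
  by exists j; rewrite ?inE.
by rewrite inE => j2 ->; rewrite imset_f.
Qed.

End TestGraphs.

Theorem theorem4p6 (r : nat) (hr : 1 < r) :
  ~ exists H : mgraph,
      connected H /\
      forall G : mgraph, simple G -> regular (2 * r) G -> colours H G.
Proof.
have r_gt0 : 0 < r by lia.
case=> H [Hconn Hcol].
have [f /colouring_vertex_map[fP [g fg]]] :=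
  Hcol _ (@rel_graph_simple _ _) (@complete_regular r).
have [h /colouring_vertex_map[hP [k hk]]] :=
  Hcol _ (@rel_graph_simple _ _) (hub_graph_regular r_gt0).
have [S [S_hub cardS]] := hub_graph_cut r_gt0.
have h_inj : {in cut S &, injective h}.
  by move=> a b /(subsetP S_hub) aN /(subsetP S_hub) bN; apply: (colouring_inj hP aN bN).
set T := odd_fibres k S.
have cardT : #|cut T| = 2.
  by rewrite (cut_odd_fibres_inj hP hk h_inj) card_in_imset.
have g_onto x : exists u, g u = x.
  by apply: (colouring_onto fP fg) => //; rewrite card_ord /= oddM.
have [c cT] : exists c, c \in cut T by apply/set0Pn; rewrite -card_gt0 cardT.
have dom (u w : vertex (complete r)) :
    u != w -> exists e : edge (complete r), ends e = [set u; w].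
  by move=> uw; apply: rel_graph_edge.
(* The cut edge [c] has an end on each side of [T]. *)
have [x xT] : exists x, x \in T.
  move: cT; rewrite inE => /odd_gt0; rewrite card_gt0.
  by case/set0Pn => x /setIP[]; exists x.
have [y yT] : exists y, y \in ~: T.
  move: cT; rewrite -cutC inE => /odd_gt0; rewrite card_gt0.
  by case/set0Pn => y /setIP[]; exists y.
have [u gu] := g_onto x; have [v gv] := g_onto y.
have := @card_preimsetC_cut _ _ _ _ fP fg T u (dom u).
have := @card_preimsetC_cut _ _ _ _ fP fg (~: T) v (dom v).
rewrite gu gv cutC cardT preimsetC setCK => /(_ yT) le1 /(_ xT) le2.
(* The preimage of [T] and its complement have at most two elements each, yet [r > 1] gives at least
   five vertices. *)
have := cardsC (g @^-1: T); rewrite card_ord.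
by lia.
Qed.
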